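(* Let $L$ and $L'$ be languages with value sets $\mathbf V$ and $\mathbf V'$, let $\mathbf Z\supseteq \mathbf V\cup\mathbf V'$, let $\sim$ be an equivalence relation on $\mathbf Z$, and let $T:\mathbb T_L\to\mathbb T_{L'}$ be a translation. Then $T$ is correct up to $\sim$ if and only if $T$ is valid up to $\sim$ and $\sim$ is a congruence for $T(L)$.
   Context: Fix a set $\mathcal V$ of variables. A language $L$ consists of a set $\mathbb T_L$ of expressions (built from variables in $\mathcal V$ by operators and possibly other constructs) and a semantic map $[\![\cdot]\!]_L:\mathbb T_L\to((\mathcal V\to\mathbf V)\to\mathbf V)$ for a set of values $\mathbf V$; maps $\rho:\mathcal V\to\mathbf V$ are valuations. Similarly $L'$ has $\mathbb T_{L'}$, $[\![\cdot]\!]_{L'}$ and values $\mathbf V'$. A translation is any map $T:\mathbb T_L\to\mathbb T_{L'}$. A semantic translation is a relation $R\subseteq\mathbf V'\times\mathbf V$ such that for every $v\in\mathbf V$ there is $v'\in\mathbf V'$ with $v' R v$. For valuations $\eta:\mathcal V\to\mathbf V'$, $\rho:\mathcal V\to\mathbf V$ write $\eta R\rho$ iff $\eta(X)R\rho(X)$ for all $X\in\mathcal V$ (similarly $\eta\sim\rho$). $T$ is correct w.r.t. $R$ if $[\![T(E)]\!]_{L'}(\eta)\,R\,[\![E]\!]_L(\rho)$ for all $E\in\mathbb T_L$ and all valuations $\eta,\rho$ with $\eta R\rho$. $T$ is correct up to an equivalence $\sim$ on $\mathbf Z$ if the restriction of $\sim$ to $\mathbf V'\times\mathbf V$ is a semantic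 translation and $T$ is correct w.r.t. it. $T$ is valid up to a preorder $\precsim$ on $\mathbf Z$ if $T$ is correct w.r.t. some semantic translation $R\subseteq\,\precsim$. Let $\mathbf U=\{v'\in\mathbf V'\mid\exists v\in\mathbf V.\ v'\sim v\}$. The equivalence $\sim$ is a congruence for $T(L)$ if $[\![T(E)]\!]_{L'}(\theta)\sim[\![T(E)]\!]_{L'}(\eta)$ for all $E\in\mathbb T_L$ and all $\theta,\eta:\mathcal V\to\mathbf U$ with $\theta\sim\eta$. *)

(* Defs.v *)
From Stdlib Require Import Ensembles Relations.

Set Implicit Arguments.
Unset Strict Implicit.

Definition elt (A : Type) (S : Ensemble A) : Type := {a : A | In A S a}.

(** The set of expressions is left abstract: no term structure is imposed. *)
Record language (Var : Type) (Val : Type) : Type := Language {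
  expr : Type;
  sem : expr -> (Var -> Val) -> Val
}.

Definition translation (Var Val Val' : Type)
    (L : language Var Val) (L' : language Var Val') : Type :=
  expr L -> expr L'.

Definition semantic_translation (Val Val' : Type) (R : Val' -> Val -> Prop) : Prop :=
  forall v : Val, exists v' : Val', R v' v.

Definition valuation_rel (Var A B : Type) (R : A -> B -> Prop)
    (eta : Var -> A) (rho : Var -> B) : Prop :=
  forall X : Var, R (eta X) (rho X).

Definition correct_wrt (Var Val Val' : Type)
    (L : language Var Val) (L' : language Var Val')
    (T : translation L L') (R : Val' -> Val -> Prop) : Prop :=
  forall (E : expr L) (eta : Var -> Val') (rho : Var -> Val),
    valuation_rel R eta rho -> R (sem (T E) eta) (sem E rho).

Definition restrict (Z : Type) (r : relation Z) (S S' : Ensemble Z)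
    (x : elt S) (y : elt S') : Prop :=
  r (proj1_sig x) (proj1_sig y).

Section UpTo.

Variables (Var Z : Type) (V V' : Ensemble Z).
Variables (L : language Var (elt V)) (L' : language Var (elt V')).
Variable T : translation L L'.

Definition correct_up_to (sim : relation Z) : Prop :=
  semantic_translation (restrict sim (S := V') (S' := V)) /\
  correct_wrt T (restrict sim (S := V') (S' := V)).

Definition valid_up_to (le : relation Z) : Prop :=
  exists R : elt V' -> elt V -> Prop,
    semantic_translation R /\
    (forall v' v, R v' v -> restrict le v' v) /\
    correct_wrt T R.

Definition target_image (sim : relation Z) : Ensemble (elt V') :=
  fun v' => exists v : elt V, restrict sim v' v.

(** Valuations into [target_image sim], which is a subset of [V'], are read as
    valuations into [V'] by forgetting the membership proofs. *)
Definition congruence_for (sim : relation Z) : Prop :=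
  forall (E : expr L) (theta eta : Var -> elt (target_image sim)),
    let theta' := fun X => proj1_sig (theta X) in
    let eta' := fun X => proj1_sig (eta X) in
    valuation_rel (restrict sim (S := V') (S' := V')) theta' eta' ->
    restrict sim (sem (T E) theta') (sem (T E) eta').

End UpTo.

(* Main.v *)
(** The idea is to compare valuations through a third one, obtained by choice.
    Two related target valuations into [U] share a source valuation, so
    correctness makes their outcomes equivalent to a common source value.
    Conversely, for [eta ~ rho] pick [theta R rho]; then [theta ~ eta], so
    validity handles [theta] and congruence transfers the result to [eta]. *)
Require Import Defs.
From Stdlib Require Import Ensembles Relations IndefiniteDescription.

Lemma correct_up_to_congruence (Var Z : Type) (V V' : Ensemble Z)
    (L : language Var (elt V)) (L' : language Var (elt V'))
    (sim : relation Z) (T : translation L L') :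
  equivalence Z sim -> correct_up_to T sim -> congruence_for T sim.
Proof.
  intros [_ Htrans Hsym] [_ Hcorr] E theta eta theta' eta' Hsim.
  (* Each [eta X] lies in the target image, hence has an equivalent source value; choice gathers
     these into [rho]. *)
  destruct (functional_choice _ (fun X => proj2_sig (eta X))) as [rho Hrho].
  apply Htrans with (proj1_sig (sem E rho)).
  - apply (Hcorr E theta' rho); intro X.
    exact (Htrans _ _ _ (Hsim X) (Hrho X)).
  - apply Hsym, (Hcorr E eta' rho Hrho).
Qed.

Lemma valid_congruence_correct_up_to (Var Z : Type) (V V' : Ensemble Z)
    (L : language Var (elt V)) (L' : language Var (elt V'))
    (sim : relation Z) (T : translation L L') :
  equivalence Z sim -> valid_up_to T sim -> congruence_for T sim ->
  correct_up_to T sim.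
Proof.
  intros [_ Htrans Hsym] [R [Hsem [Hle HR]]] Hcong; split.
  - intro v; destruct (Hsem v) as [v' Hv']; exists v'; exact (Hle _ _ Hv').
  - intros E eta rho Heta.
    (* [R] may be strictly finer than [sim], so [eta] itself need not be [R]-related to [rho]. *)
    destruct (functional_choice _ (fun X => Hsem (rho X))) as [theta Htheta].
    set (U := target_image V (V' := V') sim).
    (* Congruence speaks only of valuations into [U]; [rho X] witnesses membership for both. *)
    assert (HetaU : forall X, In _ U (eta X))
      by (intro X; exists (rho X); apply Heta).
    assert (HthetaU : forall X, In _ U (theta X))
      by (intro X; exists (rho X); apply Hle, Htheta).
    apply Htrans with (proj1_sig (sem (T E) theta)).
    + apply (Hcong E (fun X => exist _ (eta X) (HetaU X))
                     (fun X => exist _ (theta X) (HthetaU X))); intro X.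
      exact (Htrans _ _ _ (Heta X) (Hsym _ _ (Hle _ _ (Htheta X)))).
    + exact (Hle _ _ (HR E theta rho Htheta)).
Qed.

Theorem theorem1 (Var Z : Type) (V V' : Ensemble Z)
    (L : language Var (elt V)) (L' : language Var (elt V'))
    (sim : relation Z) (sim_equiv : equivalence Z sim)
    (T : translation L L') :
  correct_up_to T sim <-> valid_up_to T sim /\ congruence_for T sim.
Proof.
  split.
  - intro Hcorr; split.
    + destruct Hcorr as [Hsem Hcorr].
      (* The largest relation allowed by validity. *)
      exists (restrict sim (S := V') (S' := V)); auto.
    + exact (correct_up_to_congruence _ _ _ _ _ _ _ _ sim_equiv Hcorr).
  - intros [Hvalid Hcong].
    exact (valid_congruence_correct_up_to _ _ _ _ _ _ _ _ sim_equiv Hvalid Hcong).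
Qed.
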